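(* Let $M$ be the weighted adjacency matrix of a finite simple loopless graph $G$ on $n$ vertices with edge weights $\operatorname{wg}(e)\in\mathbb{Z}[w,r]$, let $X=\operatorname{diag}(x_1,\ldots,x_n)$ with $x_1,\dots,x_n$ commuting indeterminates, and let $C_k(M)$ be the total weight of the unoriented simple $k$-cycles of $G$. Then $$\operatorname{sq}\Bigl(-\log\det\bigl(I-tXM\bigr)\Bigr)=\Bigl(\sum_{e\in E(G)}\operatorname{wg}(e)^2\Bigr)t^2+2\sum_{k\ge3}C_k(M)\,t^k .$$ In particular the coefficient of $t^1$ vanishes, and the right-hand side is a polynomial in $t$ of degree at most $n$.
   Context: The weighted adjacency matrix $M=(m_{ij})$ of $G$ (vertices $v_1,\ldots,v_n$) is the symmetric matrix with $m_{ij}=\operatorname{wg}(e)$ if $v_i,v_j$ are joined by an edge $e$, and $m_{ij}=0$ otherwise. The weight of a cycle $C$ is $\prod_{e\in E(C)}\operatorname{wg}(e)$, and $C_k(M)$ is the sum of the weights of all unoriented simple cycles of length $k$ in $G$. The logarithm is the formal one, $\log(1+u)=\sum_{j\ge1}(-1)^{j+1}u^j/j$; since $\det(I-tXM)\in1+t\,\mathbb{Z}[w,r][x_1,\ldots,x_n][t]$, the series $-\log\det(I-tXM)$ is a well-defined element of $t\,\mathbb{Q}[w,r][x_1,\ldots,x_n][[t]]$. For $P=\sum_\alpha c_\alpha x^\alpha\in\mathbb{Q}[w,r][x_1,\ldots,x_n]$, $\operatorname{sq}(P)=\sum_{\alpha\in\{0,1\}^n}c_\alpha$ is the sum of the coefficients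 of the squarefree (multilinear) monomials; it is extended coefficientwise to power series in $t$: $\operatorname{sq}(\sum_kP_kt^k)=\sum_k\operatorname{sq}(P_k)t^k$. *)

(* Defs.v *)
From HB Require Import structures.
From mathcomp Require Import all_boot all_order all_algebra.
From mathcomp Require Import mpoly.

Set Implicit Arguments.
Unset Strict Implicit.
Unset Printing Implicit Defensive.

Import GRing.Theory.
Local Open Scope ring_scope.

(* w and r are the two variables of {mpoly _[2]}. *)
Notation Zwr := {mpoly int[2]}.
Notation Qwr := {mpoly rat[2]}.
Notation Qwrx n := {mpoly {mpoly rat[2]}[n]}.

Definition toQ (p : Zwr) : Qwr := map_mpoly (intr : int -> rat) p.

(* Formal power series in t are represented by their coefficient sequences. *)
Definition fps (R : Type) := nat -> R.

Section Graph.
Variable n : nat.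

(* A simple loopless graph on the vertex set 'I_n is given by its edge set. *)
Definition is_graph (G : {set {set 'I_n}}) : Prop :=
  forall e : {set 'I_n}, e \in G -> #|e| = 2%N.

Variables (G : {set {set 'I_n}}) (wg : {set 'I_n} -> Zwr).

(* Only the values of [wg] on the edges of [G] are used. *)
Definition wadj : 'M[Zwr]_n :=
  \matrix_(i, j) if [set i; j] \in G then wg [set i; j] else 0.

Definition adj : rel 'I_n := [rel i j | [set i; j] \in G].

Definition cycle_edges (c : seq 'I_n) : {set {set 'I_n}} :=
  [set [set i; next c i] | i in c].

(* An unoriented simple cycle of length k is identified with its edge set, so
   that the 2k closed vertex sequences traversing it count only once. *)
Definition simple_cycles (k : nat) : {set {set {set 'I_n}}} :=
  [set C : {set {set 'I_n}} | (3 <= k)%N &&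
    [exists c : k.-tuple 'I_n,
      [&& uniq c, cycle adj c & C == cycle_edges c]]].

Definition cycle_sum (k : nat) : Zwr :=
  \sum_(C in simple_cycles k) \prod_(e in C) wg e.

Definition cycle_series : fps Zwr := fun k =>
  if k == 2%N then \sum_(e in G) wg e ^+ 2
  else if (3 <= k)%N then cycle_sum k *+ 2 else 0.

End Graph.

Section LogDet.
Variable n : nat.

Definition Xdiag : 'M[Qwrx n]_n := diag_mx (\row_i 'X_i).

(* The indeterminate t is the variable of the outer {poly _}. *)
Definition det_ItXM (M : 'M[Zwr]_n) : {poly Qwrx n} :=
  \det (1%:M - 'X *: map_mx polyC
         (Xdiag *m map_mx (fun p => (toQ p)%:MP_[n]) M)).

(* log p = \sum_(j >= 1) (-1)^(j+1) (p - 1)^j / j, for p with constant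
   coefficient 1; by [coef_exp_gt] the terms with j > k do not contribute to
   the coefficient of t^k. *)
Definition flog (p : {poly Qwrx n}) : fps (Qwrx n) := fun k =>
  \sum_(1 <= j < k.+1)
     (((-1) ^+ j.+1 / j%:R : rat)%:MP_[2])%:MP_[n] * ((p - 1) ^+ j)`_k.

(* The exponents alpha in {0,1}^n are given by their boolean indicator. *)
Definition sq (P : Qwrx n) : Qwr :=
  \sum_(a : {ffun 'I_n -> bool}) P@_[multinom (a i : nat) | i < n].

Lemma coef_exp_gt (p : {poly Qwrx n}) (j k : nat) :
  p`_0 = 1 -> (k < j)%N -> ((p - 1) ^+ j)`_k = 0.
Proof.
move=> p0; have /factor_theorem[q ->]: root (p - 1) 0.
  by rewrite /root horner_coef0 coefB coef1 p0 subrr.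
by rewrite subr0 exprMn coefMXn => ->.
Qed.

Lemma coef0_det_ItXM (M : 'M[Zwr]_n) : (det_ItXM M)`_0 = 1.
Proof.
rewrite -horner_coef0 -horner_evalE -det_map_mx -[RHS](det1 _ n).
congr (\det _); apply/matrixP=> i j.
by rewrite !mxE /= /horner_eval hornerD hornerN hornerM hornerX mul0r subr0
  hornerMn hornerC.
Qed.

End LogDet.

(* Main.v *)
(* With A = X M, Jacobi's formula gives d/dt log det (I - t A)
   = - \sum_i tr (A ^ i.+1) t ^ i, so k times the coefficient of t^k in
   - log det (I - t A) is tr (A ^ k), the generating sum of the closed walks of
   length k.  The map sq keeps exactly the walks with pairwise distinct vertices.
   These are the traversals of simple cycles, and for k >= 3 every cycle has 2k
   of them (a traversal is determined by its first directed edge); for k = 2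
   they go back and forth along an edge, which has 2 orderings. *)
From HB Require Import structures.
Require Import Defs.
From mathcomp Require Import all_boot all_order all_algebra.
From mathcomp Require Import mpoly.

Import GRing.Theory.
Local Open Scope ring_scope.

Set Implicit Arguments.
Unset Strict Implicit.
Unset Printing Implicit Defensive.

(** * Derivative of a determinant and of the formal logarithm *)

Lemma deriv_prod_seq (R : comNzRingType) (I : eqType) (r : seq I)
    (F : I -> {poly R}) : uniq r ->
  (\prod_(i <- r) F i)^`() =
  \sum_(i <- r) (F i)^`() * \prod_(j <- r | j != i) F j.
Proof.
elim: r => [|x r IHr] /=; first by rewrite !big_nil derivC.
case/andP=> xr ur; rewrite !big_cons derivM eqxx IHr //.
congr (_ * _ + _).
  rewrite big_seq [RHS]big_seq_cond; apply: eq_bigl => j.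
  by case: eqP => [->|]; rewrite ?(negPf xr) ?andbT.
rewrite mulr_sumr; apply: eq_big_seq => i ir.
have xi : x != i by apply: contraNneq xr => ->.
by rewrite big_cons xi mulrCA.
Qed.

(* Jacobi's formula, read off the Laplace expansion along each row. *)
Lemma deriv_det (R : comNzRingType) (n : nat) (A : 'M[{poly R}]_n) :
  (\det A)^`() = \tr (\adj A *m map_mx (fun p => p^`()) A).
Proof.
pose B i : 'M_n := \matrix_(k, l) if k == i then (A k l)^`() else A k l.
transitivity (\sum_i \det (B i)).
  rewrite /determinant raddf_sum /= exchange_big /=; apply: eq_bigr => s _.
  have derivMsign (b : bool) c :
      ((-1) ^+ b * c)^`() = (-1) ^+ b * c^`() :> {poly R}.
    by case: b; rewrite ?expr1 ?expr0 ?mulN1r ?mul1r ?derivN.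
  rewrite derivMsign -mulr_sumr.
  congr (_ * _); rewrite deriv_prod_seq ?index_enum_uniq //.
  apply: eq_bigr => i _; rewrite [RHS](bigD1 i) //= mxE eqxx; congr (_ * _).
  by apply: eq_bigr => j /negPf ji; rewrite mxE ji.
rewrite mxtrace_mulC; apply: eq_bigr => i _.
rewrite (expand_det_row _ i) mxE; apply: eq_bigr => j _.
(* [B i] and [A] differ only in row [i], which the minors along that row delete, so the cofactors
   agree. *)
rewrite !mxE eqxx; congr (_ * (_ * \det _)).
by apply/matrixP => k l; rewrite !mxE eq_sym (negPf (neq_lift i k)).
Qed.

(** By Jacobi's formula and [adj (1 - tA) (1 - tA) = D], the geometric sum of the powers of [tA]
    telescopes. The multiple of ['X^N] encodes a congruence modulo [t^N], which keeps the argument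
    inside polynomials. *)
Lemma deriv_det_trace (R : comNzRingType) (n N : nat) (A : 'M[R]_n) :
  let D := \det (1%:M - 'X *: map_mx polyC A) in
  exists q, D^`() + D * \poly_(i < N) \tr (A ^+ i.+1) = 'X^N * q.
Proof.
set C := map_mx polyC A; set B := 'X *: C => D.
have BX i : B ^+ i = 'X^i *: map_mx polyC (A ^+ i).
  elim: i => [|i IHi]; first by rewrite !expr0 scale1r map_mx1.
  rewrite !exprSr IHi -!mulmxE map_mxM /B -scalemxAr -scalemxAl scalerA.
  by rewrite mulrC.
have dB : map_mx (fun p => p^`()) (1%:M - B) = - C.
  apply/matrixP => i j; rewrite !mxE derivB derivM derivX derivC mulr0 addr0.
  by rewrite mul1r -mulr_natr derivM derivC mul0r -[_%:R]polyC_natr derivC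
    mulr0 addr0 sub0r.
have -> : \poly_(i < N) \tr (A ^+ i.+1) = \tr ((\sum_(i < N) B ^+ i) *m C).
  rewrite poly_def mulmx_suml raddf_sum /=; apply: eq_bigr => i _.
  rewrite BX -scalemxAl mxtraceZ -map_mxM /= exprSr -mulmxE -mul_polyC mulrC.
  by rewrite -(trace_map_mx polyC).
(* The witness comes from the remainder [B ^+ N], which is [t^N] times [A ^+ N]. *)
exists (- \tr (\adj (1%:M - B) *m map_mx polyC (A ^+ N) *m C)).
rewrite deriv_det dB mulmxN raddfN /= -mxtraceZ -[D *: _]mul_scalar_mx.
rewrite mulmxA -mul_adj_mx -!mulmxA [(1%:M - B) *m _]mulmxA.
have -> : (1%:M - B) *m (\sum_(i < N) B ^+ i) = 1%:M - B ^+ N.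
  by rewrite -[LHS]opprK -mulNmx opprB mulmxE -subrX1 opprB.
rewrite mulmxBl mul1mx mulmxBr raddfB /= addKr.
by rewrite BX -scalemxAl -scalemxAr mxtraceZ mulrN.
Qed.

(** Constant coefficient 1 makes [p] a unit modulo [t^N], so it can be cancelled. *)
Lemma coef_small_eq0 (R : comNzRingType) (p f q : {poly R}) (N k : nat) :
  p`_0 = 1 -> p * f = 'X^N * q -> (k < N)%N -> f`_k = 0.
Proof.
move=> p0 pf; elim/ltn_ind: k => k IHk kN.
have := congr1 (fun r : {poly R} => r`_k) pf.
rewrite coefXnM kN coefM big_ord_recl p0 mul1r subn0 big1 ?addr0 // => i _.
have ltk : (k - lift ord0 i < k)%N.
  by rewrite lift0 ltn_subrL /= (leq_ltn_trans (leq0n i) (ltn_ord i)).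
by rewrite IHk ?mulr0 // (ltn_trans ltk kN).
Qed.

(** Cutting the logarithm after [u ^+ N] and differentiating gives the derivative of [p] times a
    geometric sum in [- u]; multiplying by [p = 1 + u] telescopes it. *)
Lemma flog_deriv (n N : nat) (p : {poly Qwrx n}) : p`_0 = 1 ->
  exists L q : {poly Qwrx n},
    (forall k, (k <= N)%N -> L`_k = flog p k) /\ p * L^`() = p^`() + 'X^N * q.
Proof.
move=> p0; pose u := p - 1.
pose c (j : nat) : Qwrx n := (((-1) ^+ j.+1 / j%:R : rat)%:MP_[2])%:MP_[n].
have [v uE] : exists v, u = 'X * v.
  have /factor_theorem[v ->] : root u 0.
    by rewrite /root horner_coef0 coefB coef1 p0 subrr.
  by exists v; rewrite subr0 mulrC.
(* The second witness is the leftover term [(- u) ^+ N], where each [u] yields one factor [t]. *)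
exists (\sum_(1 <= j < N.+1) (c j)%:P * u ^+ j), (- ((- v) ^+ N * p^`())).
split=> [k kN|].
  rewrite coef_sum (big_cat_nat (n := k.+1)) //= [X in _ + X]big1_seq ?addr0.
    by rewrite /flog; apply: eq_bigr => j _; rewrite coefCM.
  move=> j; rewrite mem_index_iota /= => /andP[kj _].
  by rewrite coefCM coef_exp_gt ?mulr0.
have du : u^`() = p^`() by rewrite derivB derivC subr0.
have -> : (\sum_(1 <= j < N.+1) (c j)%:P * u ^+ j)^`()
          = p^`() * \sum_(i < N) (- u) ^+ i.
  rewrite raddf_sum /= big_add1 big_mkord mulr_sumr; apply: eq_bigr => i _.
  rewrite deriv_mulC deriv_exp du /= -mulrnAr mulrCA; congr (_ * _).
  rewrite -mulr_natl mulrA -polyC_natr -polyCM (_ : c i.+1 * i.+1%:R = (-1) ^+ i).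
    by rewrite [RHS]exprNn polyC_exp polyCN.
  rewrite /c -mpolyC_nat -mpolyC_nat -!mpolyCM divfK.
    by rewrite !exprS mulrA mulrNN !mul1r !rmorphXn !rmorphN1.
  by rewrite Num.Theory.pnatr_eq0.
have pu : p = - (- u - 1) by rewrite /u opprB opprK addrC subrK.
rewrite {1}pu mulrCA mulNr -subrX1 opprB mulrBr mulr1; congr (_ + _).
by rewrite uE -[- ('X * v)]mulrN exprMn mulrN mulrCA [_ * p^`()]mulrC.
Qed.

(** Both truncated logarithmic derivatives carry the factor [det_ItXM M], which is cancelled. The
    indicator of [k != 0] is there because the trace of the zeroth power is [n], not 0. *)
Lemma flog_det_ItXM (n k : nat) (M : 'M[Zwr]_n) :
  flog (det_ItXM M) k *+ k
  = - \tr ((Xdiag n *m map_mx (fun p => (toQ p)%:MP_[n]) M) ^+ k) *+ (k != 0)%N.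
Proof.
case: k => [|k]; first by rewrite !mulr0n.
have D0 := coef0_det_ItXM M; set A := _ *m _.
have [q1 Dtr] := deriv_det_trace k.+1 A.
have [L [q2 [Lk DL]]] := flog_deriv k.+1 D0.
set T := \poly_(i < _) _ in Dtr.
have DLT : det_ItXM M * (L^`() + T) = 'X^(k.+1) * (q1 + q2).
  by rewrite mulrDr DL addrAC Dtr mulrDr.
have := coef_small_eq0 D0 DLT (ltnSn k).
rewrite coefD coef_deriv Lk // => /eqP; rewrite addr_eq0 => /eqP ->.
by rewrite mulr1n coef_poly ltnSn.
Qed.

(** * Traces of matrix powers as sums over closed walks *)

Fixpoint walk_weight (R : pzRingType) (n : nat) (A : 'M[R]_n) (i : 'I_n)
    (s : seq 'I_n) (j : 'I_n) : R :=
  if s is x :: s' then A i x * walk_weight A x s' j else A i j.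

Lemma sum_tuple_cons (V : nmodType) (T : finType) (k : nat) (F : seq T -> V) :
  \sum_(c : k.+1.-tuple T) F c = \sum_x \sum_(c : k.-tuple T) F (x :: c).
Proof.
rewrite pair_big /=; apply: (reindex (fun p : T * k.-tuple T => [tuple of p.1 :: p.2])).
exists (fun c : k.+1.-tuple T => (thead c, [tuple of behead c])) => [[x c] _|c _] /=.
  by rewrite theadE; congr pair; apply: val_inj.
by rewrite [RHS]tuple_eta; apply: val_inj.
Qed.

Lemma exprmx_walk (R : pzRingType) (n k : nat) (A : 'M[R]_n) (i j : 'I_n) :
  (A ^+ k.+1) i j = \sum_(c : k.-tuple 'I_n) walk_weight A i c j.
Proof.
elim: k i => [|k IHk] i.
  rewrite expr1 (big_pred1 [tuple]) // => c; apply/esym/eqP/tuple0.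
rewrite exprS -mulmxE mxE (sum_tuple_cons k (fun c => walk_weight A i c j)).
by apply: eq_bigr => x _; rewrite IHk mulr_sumr.
Qed.

(** The walk closes up by returning to the head of the list. The value on the empty list is a
    default, never met at positive length. *)
Definition cycle_weight (R : pzRingType) (n : nat) (A : 'M[R]_n) (c : seq 'I_n) : R :=
  if c is x :: s then walk_weight A x s x else 0.

Lemma trace_exprmx (R : pzRingType) (n k : nat) (A : 'M[R]_n) : (0 < k)%N ->
  \tr (A ^+ k) = \sum_(c : k.-tuple 'I_n) cycle_weight A c.
Proof.
case: k => // k _; rewrite (sum_tuple_cons k (cycle_weight A)).
by apply: eq_bigr => i _; rewrite exprmx_walk.
Qed.

Lemma cycle_weight_next (R : pzRingType) (n : nat) (A : 'M[R]_n) (c : seq 'I_n) :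
  uniq c -> c != [::] -> cycle_weight A c = \prod_(x <- c) A x (next c x).
Proof.
case: c => [|y0 s] //= us _.
(* The closing vertex [y0] stays fixed while the induction moves the current vertex [y]. *)
suff gen y : uniq (y :: s) -> walk_weight A y s y0
    = \prod_(x <- y :: s) A x (next_at x y0 y s) by rewrite gen.
elim: s y {us} => [|y' s IHs] y /=; first by rewrite big_seq1 eqxx.
move=> /andP[ys us]; rewrite big_cons /= eqxx IHs //; congr (_ * _).
by apply: eq_big_seq => x xs; case: eqP => // xy; rewrite -xy xs in ys.
Qed.

(** Each step is charged to the vertex it leaves; for [Xdiag] this splits off the vertex monomial
    that [sq] inspects. *)
Lemma cycle_weight_mulrow (R : comPzRingType) (n : nat) (d : 'rV[R]_n) (A : 'M[R]_n)
    (c : seq 'I_n) :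
  cycle_weight (diag_mx d *m A) c = (\prod_(x <- c) d 0 x) * cycle_weight A c.
Proof.
case: c => [|y0 s] /=; first by rewrite mulr0.
have dA x y : (diag_mx d *m A) x y = d 0 x * A x y by rewrite mul_diag_mx mxE.
suff gen y : walk_weight (diag_mx d *m A) y s y0
    = (\prod_(x <- y :: s) d 0 x) * walk_weight A y s y0 by rewrite gen.
elim: s y => [|x s IHs] y /=; rewrite dA.
  by rewrite big_seq1.
by rewrite IHs [in RHS]big_cons -!mulrA; congr (_ * _); rewrite mulrCA.
Qed.

Lemma cycle_weight_map (R S : pzRingType) (f : {rmorphism R -> S}) (n : nat)
    (A : 'M[R]_n) (c : seq 'I_n) :
  cycle_weight (map_mx f A) c = f (cycle_weight A c).
Proof.
case: c => [|y0 s] /=; first by rewrite rmorph0.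
suff gen y : walk_weight (map_mx f A) y s y0 = f (walk_weight A y s y0) by rewrite gen.
elim: s y => [|x s IHs] y /=; first by rewrite mxE.
by rewrite IHs mxE rmorphM.
Qed.

(** * Squarefree extraction *)

Lemma sq_is_nmod_morphism (n : nat) : nmod_morphism (@sq n).
Proof.
split=> [|P Q]; first by rewrite /sq big1 // => a _; rewrite mcoeff0.
by rewrite -big_split; apply: eq_bigr => a _; rewrite mcoeffD.
Qed.

HB.instance Definition _ (n : nat) :=
  GRing.isNmodMorphism.Build (Qwrx n) Qwr (@sq n) (@sq_is_nmod_morphism n).

(** The exponent of each variable is its multiplicity in [s]; if [s] has no repetition, exactly one
    indicator matches the monomial. *)
Lemma sq_prodXC (n : nat) (s : seq 'I_n) (c : Qwr) :
  sq ((\prod_(x <- s) 'X_x) * c%:MP_[n]) = if uniq s then c else 0.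
Proof.
rewrite mulrC mprodXE; set m := (\sum_(x <- s) _)%MM.
have mE i : m i = count_mem i s.
  rewrite mnm_sumE -sum1_count [RHS]big_mkcond /=; apply: eq_bigr => x _.
  by rewrite mnm1E; case: eqP.
have coefE a : (c%:MP_[n] * 'X_[m])@_a = c * (m == a)%:R.
  by rewrite mcoeffCM mcoeffX.
rewrite /sq; under eq_bigr do rewrite coefE.
case: ifP => us.
  rewrite (bigD1 [ffun i => i \in s]) //= big1 ?addr0 => [|a neq].
    rewrite (_ : m == _) ?mulr1 //; apply/eqP/mnmP => i.
    by rewrite mnmE mE ffunE count_uniq_mem.
  case: eqP => [ma|_]; last by rewrite mulr0.
  case/eqP: neq; apply/ffunP => i; move/mnmP/(_ i): ma.
  by rewrite ffunE mnmE mE count_uniq_mem //; case: (i \in s); case: (a i).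
apply: big1 => a _; case: eqP => [ma|_]; last by rewrite mulr0.
case/negP: us; apply: count_mem_uniq => i.
have /mnmP/(_ i) := ma; rewrite mnmE mE -has_pred1 has_count => ->.
by case: (a i).
Qed.

(** * Simple cycles and their traversals *)

Lemma next_head (T : eqType) (x y : T) (s : seq T) : next [:: x, y & s] x = y.
Proof. by rewrite /= eqxx. Qed.

Lemma rot_to_next (T : eqType) (c : seq T) (x : T) : uniq c -> x \in c ->
  exists s i, [/\ rot i c = x :: s, uniq (x :: s) & next c =1 next (x :: s)].
Proof.
move=> uc /rot_to[i s def]; exists s, i; rewrite -def rot_uniq; split => //.
by move=> y; rewrite next_rot.
Qed.

(** Rotating [x] to the front exhibits three distinct vertices. The absence of immediate
    backtracking is what tells the two orientations apart. *)
Lemma next_neq (T : eqType) (c : seq T) (x : T) : uniq c -> (2 < size c)%N ->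
  x \in c -> next c x != x /\ next c (next c x) != x.
Proof.
move=> uc sc xc; have [s [i [def us nextE]]] := rot_to_next uc xc.
have: size (x :: s) = size c by rewrite -def size_rot.
case: s {def} us nextE => [|y [|z s]] us nextE ss; rewrite -ss // in sc.
rewrite !nextE next_head /= in us *; move: us; rewrite !inE !negb_or.
case/and3P => /and3P[xy xz _] _ _.
by rewrite !(eq_sym _ x) (negPf xy) eqxx.
Qed.

Lemma cycle_edges_rot (n i : nat) (c : seq 'I_n) : uniq c ->
  cycle_edges (rot i c) = cycle_edges c.
Proof.
move=> uc; apply/setP=> e; apply/imsetP/imsetP => -[x xc ->]; exists x;
  by rewrite ?next_rot ?mem_rot // -(mem_rot i).
Qed.

Lemma cycle_edges_rev (n : nat) (c : seq 'I_n) : uniq c ->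
  cycle_edges (rev c) = cycle_edges c.
Proof.
move=> uc; apply/setP=> e; apply/imsetP/imsetP => -[x xc ->].
  rewrite mem_rev in xc; exists (prev c x); first by rewrite mem_prev.
  by rewrite next_rev // next_prev // setUC.
exists (next c x); first by rewrite mem_rev mem_next.
by rewrite next_rev // prev_next // setUC.
Qed.

Lemma set2_inj (T : finType) (x y z t : T) : [set x; y] = [set z; t] ->
  x = z /\ y = t \/ x = t /\ y = z.
Proof.
move/setP=> E; have := E x; have := E y; have := E z; have := E t.
rewrite !inE !eqxx !orbT /=.
by do !case: eqP => [?|?] //=; subst; auto.
Qed.

(** Distinct vertices with the same edge would be each other's successors, which is backtracking. *)
Lemma cycle_edge_inj (n : nat) (c : seq 'I_n) : uniq c -> (2 < size c)%N ->
  {in c &, injective (fun x => [set x; next c x])}.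
Proof.
move=> uc sc x y xc yc /set2_inj[[]//|[xy yx]].
by have [_] := next_neq uc sc xc; rewrite yx -xy eqxx.
Qed.

Lemma cycle_adj (n : nat) (G : {set {set 'I_n}}) (c : seq 'I_n) : uniq c ->
  cycle (adj G) c = (cycle_edges c \subset G).
Proof.
move=> uc; apply/idP/subsetP => [cG _ /imsetP[x xc ->]|sub].
  exact: (next_cycle cG xc).
apply: (@sub_in_cycle _ (mem c)) (cycle_next uc); last exact/allP.
by move=> x y xc _ /eqP <-; apply: sub; apply/imsetP; exists x.
Qed.

(* A vertex of a cycle lies on exactly two edges, so a traversal never has a
   choice after its first step. *)
Lemma cycle_edges_inj (n : nat) (c d : seq 'I_n) (x : 'I_n) (s t : seq 'I_n) :
    c = x :: s -> d = x :: t -> uniq c -> uniq d -> (2 < size c)%N ->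
    size c = size d -> cycle_edges c = cycle_edges d -> next c x = next d x ->
  c = d.
Proof.
move=> cE dE uc ud sc scd E nextx; have sd : (2 < size d)%N by rewrite -scd.
have step y : y \in c -> y \in d -> next c y = next d y ->
    next c (next c y) = next d (next c y).
  move=> yc yd nexty; set z := next c y.
  have zc : z \in c by rewrite mem_next.
  have : [set z; next c z] \in cycle_edges d by rewrite -E; apply: imset_f.
  case/imsetP => u ud' /set2_inj[[-> //]|[zu zz]].
  (* In the remaining case [d] enters [z] from [u], so [u = y], and [c] would step back from [z] to
     [y]. *)
  have uy : u = y by rewrite -(prev_next ud u) -zu /z nexty prev_next.
  by have [_] := next_neq uc sc yc; rewrite -/z zz uy eqxx.
have iterE i : iter i (next c) x = iter i (next d) x /\
    [/\ iter i (next c) x \in c, iter i (next c) x \in d &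
     next c (iter i (next c) x) = next d (iter i (next c) x)].
  elim: i => [|i [IH [yc yd nexty]]] /=; first by rewrite cE dE !inE eqxx -{1}cE -dE.
  rewrite -IH nexty; split=> //; rewrite -{1}nexty mem_next -{2}nexty; split => //.
    by rewrite mem_next.
  by rewrite -nexty step.
(* Each list is the orbit of its head under its successor map, so it suffices to compare the
   orbits. *)
have traj (e r : seq 'I_n) : e = x :: r -> uniq e ->
    r = traject (next e) (next e x) (size r).
  move=> eE ue; apply: fpathE; have := cycle_next ue.
  by rewrite {2}eE /= rcons_path => /andP[].
rewrite cE dE (traj _ _ cE uc) (traj _ _ dE ud); congr cons.
have <- : size s = size t by move: scd; rewrite cE dE => -[].
rewrite -nextx; apply: (@eq_from_nth _ (next c x)) => [|i];
  rewrite !size_traject // => lti.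
by rewrite !nth_traject // {2}nextx -!iterSr; case: (iterE i.+1).
Qed.

(** A traversal is encoded by its first arc. The possible arcs are the [k] forward ones in [A] and
    the [k] backward ones in [B], disjoint because there is no backtracking. *)
Lemma card_traversals (n k : nat) (c : k.-tuple 'I_n) : uniq c -> (2 < k)%N ->
  #|[set d : k.-tuple 'I_n | uniq d & cycle_edges d == cycle_edges c]| = (k * 2)%N.
Proof.
move=> uc k_gt2; set F := [set d | _ & _].
have sz (d : k.-tuple 'I_n) : (2 < size d)%N by rewrite size_tuple.
have [x0 _] : exists x, x \in (c : seq _).
  by case: (tval c) (sz c) => // x s _; exists x; rewrite mem_head.
pose arc (d : k.-tuple 'I_n) := (head x0 d, next d (head x0 d)).
have headE (d : k.-tuple 'I_n) : exists s, tval d = head x0 d :: s.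
  by case: (tval d) (sz d) => // x s; exists s.
have injarc : {in F &, injective arc}.
  move=> d e; rewrite !inE => /andP[ud /eqP Ed] /andP[ue /eqP Ee] [hd nd].
  have [[s dE] [t eE]] := (headE d, headE e); rewrite -hd in nd eE.
  apply: val_inj; apply: (cycle_edges_inj dE eE) => //.
    by rewrite !size_tuple.
  by rewrite Ed Ee.
rewrite -(card_in_imset injarc).
pose A := [set (x, next c x) | x in c]; pose B := [set (next c x, x) | x in c].
have -> : arc @: F = A :|: B.
  apply/setP => -[x y]; rewrite in_setU; apply/imsetP/orP => [[d]|].
    rewrite inE => /andP[ud /eqP Ed] [-> ->].
    have hd : head x0 d \in (d : seq _) by have [s ->] := headE d; rewrite mem_head.
    have : [set head x0 d; next d (head x0 d)] \in cycle_edges c.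
      by rewrite -Ed; apply: imset_f.
    case/imsetP => z zc /set2_inj[[-> ->]|[-> ->]].
      by left; apply: imset_f.
    by right; apply: (imset_f (fun x => (next c x, x))).
  (* Every arc is reached by a rotation: of [c] for a forward arc, of [rev c] for a backward one. *)
  have rotE (e : k.-tuple 'I_n) z : uniq e -> cycle_edges e = cycle_edges c -> z \in e ->
      exists2 d, d \in F & (z, next e z) = arc d.
    move=> ue Ee ze; have [s [i [def _ _]]] := rot_to_next ue ze.
    exists [tuple of rot i e].
      by rewrite inE rot_uniq ue /= cycle_edges_rot // Ee.
    have hd : head x0 (rot i e) = z by rewrite def.
    by rewrite /arc /= next_rot // hd.
  case=> /imsetP[z zc [-> ->]]; first exact: rotE.
  have := rotE [tuple of rev c] (next c z); rewrite rev_uniq next_rev // prev_next //.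
  by apply; rewrite // ?cycle_edges_rev // mem_rev mem_next.
rewrite cardsU (_ : A :&: B = set0) ?cards0 ?subn0.
  rewrite !card_in_imset ?(card_uniqP uc) ?size_tuple ?muln2 ?addnn //.
    by move=> x y _ _ [].
  by move=> x y _ _ [].
apply/setP => p; rewrite !inE; apply/negP.
case/andP=> /imsetP[x xc ->] /imsetP[y yc [xy yx]].
by have [_] := next_neq uc (sz c) xc; rewrite yx -xy eqxx.
Qed.

(* Closed walks of length 2 traverse an edge back and forth: each edge arises
   from its two orderings. *)
Lemma sum_cycle_weight2 (n : nat) (G : {set {set 'I_n}}) (wg : {set 'I_n} -> Zwr) :
  is_graph G ->
  \sum_(c : 2.-tuple 'I_n | uniq c) cycle_weight (wadj G wg) c
  = (\sum_(e in G) wg e ^+ 2) *+ 2.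
Proof.
move=> hG; pose supp (c : 2.-tuple 'I_n) := [set x in c].
rewrite (bigID (fun c => supp c \in G)) /= [X in _ + X]big1 ?addr0; last first.
  case=> -[|x [|y [|z s]]] // sz /andP[_]; rewrite /= !mxE.
  rewrite (_ : supp _ = [set x; y]) => [/negPf ->|]; first by rewrite mul0r.
  by apply/setP => z; rewrite !inE.
rewrite (partition_big supp (mem G)) => [|c /andP[]] //=.
rewrite -sumrMnl; apply: eq_bigr => e eG.
(* Over a fixed edge [e] the tuples are its orderings, counted by the falling factorial
   [2 ^_ 2 = 2]. *)
transitivity (\sum_(c in [set c : 2.-tuple 'I_n | all (mem e) c & uniq c]) wg e ^+ 2).
  apply: eq_big => [c|].
    rewrite inE; apply/andP/andP => [[/andP[uc _] /eqP <-]|[/allP ce uc]].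
      by split=> //; apply/allP => x xc; rewrite /= inE.
    have ec : supp c = e.
      apply/eqP; rewrite eqEcard (hG e eG) cardsE (card_uniqP uc) size_tuple leqnn.
      by rewrite andbT; apply/subsetP => x; rewrite inE => /ce.
    by rewrite ec eG uc.
  case=> -[|x [|y [|z s]]] // sz /andP[_ /eqP].
  rewrite (_ : supp _ = [set x; y]) => [ee|]; last by apply/setP => z; rewrite !inE.
  by rewrite -ee in eG *; rewrite /= !mxE [[set y; x]]setUC eG.
by rewrite sumr_const card_uniq_tuples (hG e eG).
Qed.

(** A tuple using a non-edge has weight 0. The others are grouped by edge set; within a group all
    weights agree and [card_traversals] gives the size. *)
Lemma sum_cycle_weight_gt2 (n : nat) (G : {set {set 'I_n}}) (wg : {set 'I_n} -> Zwr)
    (k : nat) : (2 < k)%N ->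
  \sum_(c : k.-tuple 'I_n | uniq c) cycle_weight (wadj G wg) c
  = cycle_sum G wg k *+ (k * 2).
Proof.
move=> k_gt2.
have sz (d : k.-tuple 'I_n) : (2 < size d)%N by rewrite size_tuple.
have nnil (d : k.-tuple 'I_n) : (d : seq _) != [::] by have := sz d; case: (tval d).
rewrite (bigID (fun c : k.-tuple 'I_n => cycle_edges c \subset G)) /=.
rewrite [X in _ + X]big1 ?addr0; last first.
  move=> c /andP[uc /subsetPn[_ /imsetP[x xc ->] eG]].
  rewrite cycle_weight_next // (big_rem x) //= mxE.
  by rewrite (negPf eG) mul0r.
rewrite (partition_big (fun c : k.-tuple 'I_n => cycle_edges c)
           (mem (simple_cycles G k))) /=; last first.
  move=> c /andP[uc cG]; rewrite inE k_gt2; apply/existsP; exists c.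
  by rewrite uc cycle_adj // cG eqxx.
rewrite /cycle_sum -sumrMnl; apply: eq_bigr => C.
rewrite inE => /andP[_ /existsP[c0 /and3P[uc0 c0G /eqP CE]]].
rewrite cycle_adj // -CE in c0G.
rewrite -(card_traversals uc0 k_gt2) -CE -sumr_const; apply: eq_big => [c|c].
  rewrite inE; case: eqP => [->|]; last by rewrite !andbF.
  by rewrite c0G !andbT.
case/andP=> /andP[uc cG] /eqP cE.
(* Since [x] determines its outgoing edge injectively, the product over edges becomes one over
   vertices. *)
rewrite cycle_weight_next // big_uniq // -cE big_imset /=; last exact: cycle_edge_inj.
apply: eq_bigr => x xc; rewrite mxE (subsetP cG) //.
exact: (imset_f (fun x => [set x; next c x])).
Qed.

(** * Comparison of coefficients *)

Lemma mulrn_inj_mpoly (n k : nat) (p q : {mpoly rat[n]}) : (0 < k)%N ->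
  p *+ k = q *+ k -> p = q.
Proof.
move=> k_gt0 /mpolyP pq; apply/mpolyP => m; have := pq m; rewrite !mcoeffMn.
by apply: Num.Theory.pmulrnI.
Qed.

Lemma sq_trace (n k : nat) (M : 'M[Zwr]_n) : (0 < k)%N ->
  sq (\tr ((Xdiag n *m map_mx (fun p => (toQ p)%:MP_[n]) M) ^+ k))
  = toQ (\sum_(c : k.-tuple 'I_n | uniq c) cycle_weight M c).
Proof.
move=> k_gt0; rewrite trace_exprmx // raddf_sum [RHS]raddf_sum [RHS]big_mkcond /=.
apply: eq_bigr => c _; rewrite cycle_weight_mulrow.
(* The entries are images under one ring morphism, so the weight of a walk becomes a constant in the
   [x] variables. *)
rewrite (cycle_weight_map (@mpolyC n Qwr \o map_mpoly (intr : int -> rat))) /=.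
by under eq_bigr do rewrite mxE; rewrite sq_prodXC.
Qed.

Lemma cycle_sum_gt (n : nat) (G : {set {set 'I_n}}) (wg : {set 'I_n} -> Zwr) (k : nat) :
  (n < k)%N -> cycle_sum G wg k = 0.
Proof.
move=> nk; rewrite /cycle_sum big1 // => C; rewrite inE => /andP[_ /existsP[c]].
case/andP=> /card_uniqP uc _; have := max_card (mem c).
by rewrite uc size_tuple card_ord leqNgt nk.
Qed.

Lemma sq_flog (n : nat) (G : {set {set 'I_n}}) (wg : {set 'I_n} -> Zwr) (k : nat) :
  is_graph G ->
  sq (- flog (det_ItXM (wadj G wg)) k) = toQ (cycle_series G wg k).
Proof.
move=> hG; case: (posnP k) => [->|k_gt0].
  by rewrite /flog big_geq // oppr0 raddf0 [RHS]raddf0.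
(* Multiplying by [k], harmless in characteristic zero, turns the logarithm into a trace. *)
apply: (mulrn_inj_mpoly k_gt0); rewrite -raddfMn mulNrn flog_det_ItXM.
rewrite -lt0n k_gt0 mulr1n opprK [LHS](sq_trace _ k_gt0) -[RHS]raddfMn; congr toQ.
rewrite /cycle_series; case: k k_gt0 => [|[|[|k]]] // _ /=.
(* A closed walk of length 1 is a loop, and a singleton is not an edge. *)
- rewrite mulr1n big1 // => -[[|x [|y s]] sz] //= _.
  rewrite mxE; case: ifP => // /hG; by rewrite setUid cards1.
- exact: sum_cycle_weight2.
- by rewrite sum_cycle_weight_gt2 // -mulrnA mulnC.
Qed.

Theorem theorem4p3 (n : nat) (G : {set {set 'I_n}})
    (wg : {set 'I_n} -> {mpoly int[2]}) (hG : is_graph G) :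
  [/\ (forall k : nat,
         sq (- flog (det_ItXM (wadj G wg)) k) = toQ (cycle_series G wg k)),
      sq (- flog (det_ItXM (wadj G wg)) 1%N) = 0
    & exists p : {poly {mpoly int[2]}},
        (size p <= n.+1)%N /\ forall k : nat, p`_k = cycle_series G wg k].
Proof.
split=> [k||]; first exact: sq_flog.
  by rewrite sq_flog // [LHS]raddf0.
(* Nothing is lost by truncating: beyond [n] there are too few vertices for a cycle, and for [n < 2]
   too few for an edge. *)
exists (\poly_(k < n.+1) cycle_series G wg k); split=> [|k]; first exact: size_poly.
rewrite coef_poly ltnS; case: leqP => // nk; rewrite /cycle_series.
case: eqP => [k2|_]; last by rewrite cycle_sum_gt // mul0rn; case: ifP.
rewrite big1 // => e /hG e2; have := max_card (mem e).
by rewrite e2 card_ord; rewrite k2 in nk; rewrite leqNgt nk.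
Qed.
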